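(* Let $(Q,\cdot,\backslash,/)$ be an algebra with three binary operations such that the identities $$x\cdot(x\backslash y) = y,\qquad (y\cdot x)/x = y,\qquad (x/y)\backslash x = y$$ hold for all $x,y\in Q$. Then $(Q,\cdot,\backslash,/)$ is a quasigroup.
   Context: An algebra $(Q,\cdot,\backslash,/)$ is a set $Q$ with three binary operations $\cdot,\backslash,/ : Q\times Q\to Q$. Such an algebra is called a quasigroup (in the equational sense of T. Evans) if the following four identities hold for all $x,y\in Q$: $x\cdot(x\backslash y)=y$; $(y/x)\cdot x=y$; $x\backslash(x\cdot y)=y$; $(y\cdot x)/x=y$. *)

(* Defs.v *)
(* Equational (Evans) quasigroups.  [ldiv x y] is x \ y and [rdiv x y] is x / y:
   the divisor is the first argument of [ldiv] and the second of [rdiv]. *)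
Record is_quasigroup (Q : Type) (mul ldiv rdiv : Q -> Q -> Q) : Prop := {
  mul_ldiv : forall x y : Q, mul x (ldiv x y) = y;
  rdiv_mul : forall x y : Q, mul (rdiv y x) x = y;
  ldiv_mul : forall x y : Q, ldiv x (mul x y) = y;
  mul_rdiv : forall x y : Q, rdiv (mul y x) x = y
}.

(* Main.v *)
Require Import Defs.

Theorem theorem2 (Q : Type) (mul ldiv rdiv : Q -> Q -> Q)
  (mul_ldiv : forall x y : Q, mul x (ldiv x y) = y)
  (mul_rdiv : forall x y : Q, rdiv (mul y x) x = y)
  (rdiv_ldiv : forall x y : Q, ldiv (rdiv x y) x = y) :
  is_quasigroup Q mul ldiv rdiv.
Proof.
  split; [exact mul_ldiv | intros x y | intros x y | exact mul_rdiv].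
  - (* (y/x)x = y is (y/x)((y/x)\y) = y, because (y/x)\y = x. *)
    pose proof (mul_ldiv (rdiv y x) y) as E.
    rewrite rdiv_ldiv in E; exact E.
  - (* x\(xy) = y is ((xy)/y)\(xy) = y, because (xy)/y = x. *)
    pose proof (rdiv_ldiv (mul x y) y) as E.
    rewrite mul_rdiv in E; exact E.
Qed.
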